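(* Let $l \geq 1$ be an integer. Let $(X,\mathcal{X},\mu)$ be a probability space and let $T_1,\ldots,T_l: X \to X$ be commuting invertible measure-preserving transformations of $(X,\mathcal{X},\mu)$. Then for any $f_1,\ldots,f_l \in L^\infty(X,\mathcal{X},\mu)$, the averages $$\frac{1}{N}\sum_{n=0}^{N-1} f_1(T_1^n x)\cdots f_l(T_l^n x)$$ (regarded as functions of $x \in X$) converge in the norm of $L^2(X,\mathcal{X},\mu)$ as $N \to \infty$.
   Context: Commuting means $T_iT_j = T_jT_i$ for all $i,j$. No ergodicity is assumed. Convergence means that there is a limit function in $L^2(X,\mathcal{X},\mu)$ to which the averages converge in $L^2$ norm. *)

(* Defs.v *)
From HB Require Import structures.
From mathcomp Require Import all_boot all_order all_algebra.
From mathcomp Require Import complex.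
From mathcomp Require Import all_classical all_reals all_analysis.

Set Implicit Arguments.
Unset Strict Implicit.
Unset Printing Implicit Defensive.
Import Order.TTheory GRing.Theory Num.Theory.
Import numFieldNormedType.Exports.
Local Open Scope classical_set_scope.
Local Open Scope ring_scope.
Local Open Scope complex_scope.

Definition measure_preserving d (X : measurableType d) (R : realType)
    (mu : {measure set X -> \bar R}) (T : X -> X) : Prop :=
  measurable_fun [set: X] T /\
  forall A : set X, measurable A -> mu (T @^-1` A) = mu A.

(* The inverse is required to be measurable; it then preserves mu as well. *)
Definition invertible_measure_preserving d (X : measurableType d)
    (R : realType) (mu : {measure set X -> \bar R}) (T : X -> X) : Prop :=
  measure_preserving mu T /\
  exists S : X -> X,
    [/\ cancel T S, cancel S T & measurable_fun [set: X] S].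

(* The library's Lp norms and Lp spaces are for real-valued functions, hence
   these complex-valued versions; Normc.normc z is the modulus of z
   as an element of R (while `|z| has type R[i]). *)
Definition cabs d (X : measurableType d) (R : realType) (f : X -> R[i]) :
    X -> R :=
  fun x => Normc.normc (f x).

Definition cLnorm d (X : measurableType d) (R : realType)
    (mu : {measure set X -> \bar R}) (p : \bar R) (f : X -> R[i]) : \bar R :=
  Lnorm mu p (EFin \o cabs f).

(* Functions are not quotiented by equality almost everywhere. *)
Definition cLfun d (X : measurableType d) (R : realType)
    (mu : {measure set X -> \bar R}) (p : \bar R) (f : X -> R[i]) : Prop :=
  [/\ measurable_fun [set: X] (fun x => complex.Re (f x)),
      measurable_fun [set: X] (fun x => complex.Im (f x)) &
      (cLnorm mu p f < +oo)%E].

Definition ergodic_average d (X : measurableType d) (R : realType) (l : nat)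
    (T : 'I_l -> X -> X) (f : 'I_l -> X -> R[i]) (N : nat) : X -> R[i] :=
  fun x => N%:R^-1 * \sum_(n < N) \prod_(i < l) f i (iter n (T i) x).

(* Main.v *)
Require Import Defs.
From HB Require Import structures.
From mathcomp Require Import all_boot all_order all_algebra.
From mathcomp Require Import complex.
From mathcomp Require Import all_classical all_reals all_analysis.
From mathcomp Require Import measurable_realfun ess_sup_inf ring lra.

Set Implicit Arguments.
Unset Strict Implicit.
Unset Printing Implicit Defensive.
Import Order.TTheory GRing.Theory Num.Theory.
Import numFieldNormedType.Exports.
Local Open Scope classical_set_scope.
Local Open Scope ring_scope.
Local Open Scope complex_scope.

(* After Walsh and Tao, by induction on the number of transformations.  The
   induction runs over abstract systems: an algebra of bounded functions with a
   positive normalised functional [tau] preserved by commuting bijections.  This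
   class is closed under ultraproducts and under averaging over a finite index
   set, so that no quantitative (metastable) form of the induction hypothesis
   is needed.
   Let [V] be the space of sequences [g], modulo an ultrafilter on the
   index, for which the averages with [g] in place of the last function are
   Cauchy.  If [h] is the last function minus a near-best approximation of it in
   [V], then [h] is almost orthogonal to [V].  Averages of [h] over windows of
   unbounded length correlate with "dual functions"
     E_(n < K) T_l^-n (a * \prod_(i < l) T_i^n f_i),  K infinite,
   and these lie in [V]: being invariant under the shift n -> n + m up to O(m/K),
   they turn the averages involving T_l into averages over n < K of averages
   involving only the other transformations.  So the averages of [h] are
   small, and the averages of the last function are Cauchy. *)

(** * Limits of bounded real sequences along an ultrafilter *)

Section UltraLimit.
Context {R : realType} (U : set_system nat) {UU : UltraFilter U}.
Context (oo_U : \oo `<=` U).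
Implicit Types u v : nat -> R.

Definition ulim u : R := lim (u k @[k --> U]).

Definition bounded_seq u := exists C : R, forall k, `|u k| <= C.

(** The interval [-C, C] is compact, so the image ultrafilter has a cluster point there, and an
    ultrafilter converges to each of its cluster points. *)
Lemma ulim_cvg u : bounded_seq u -> u k @[k --> U] --> ulim u.
Proof.
move=> [C uC]; apply/cvg_ex.
have FU : U (u @^-1` `[- C, C]%classic).
  by apply: filterS filterT => k _ /=; rewrite in_itv /= -ler_norml.
have [p [_ clp]] := @segment_compact R (- C) C (u @ U) _ FU.
exists p => B nB; have [//|UnB] := in_ultra_setVsetC (u @^-1` B) UU.
have /(_ UnB nB) [x [/= nBx Bx]] := clp (~` B) B.
by [].
Qed.

Lemma ulim_eq u l : u k @[k --> U] --> l -> ulim u = l.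
Proof. by move=> ul; apply: cvg_lim. Qed.

Lemma ulimD u v : bounded_seq u -> bounded_seq v ->
  ulim (fun k => u k + v k) = ulim u + ulim v.
Proof. by move=> bu bv; apply: ulim_eq; apply: cvgD; exact: ulim_cvg. Qed.

Lemma ulimZ c u : bounded_seq u -> ulim (fun k => c * u k) = c * ulim u.
Proof. by move=> bu; apply: ulim_eq; apply: cvgMr; exact: ulim_cvg. Qed.

Lemma ulim_cst c : ulim (fun=> c) = c.
Proof. by apply: ulim_eq; exact: cvg_cst. Qed.

Lemma ulim_ge c u : bounded_seq u -> U [set k | c <= u k] -> c <= ulim u.
Proof.
by move=> bu cu; apply: ler_cvg_to cu; [exact: cvg_cst|exact: ulim_cvg].
Qed.

Lemma ulim_le c u : bounded_seq u -> U [set k | u k <= c] -> ulim u <= c.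
Proof.
by move=> bu uc; apply: ler_cvg_to uc; [exact: ulim_cvg|exact: cvg_cst].
Qed.

Lemma ulim_gt c u : bounded_seq u -> c < ulim u -> U [set k | c < u k].
Proof. by move=> bu cu; apply: cvgr_gt (ulim_cvg bu) _ cu. Qed.

Lemma ulim_eventually_le u v : bounded_seq u -> bounded_seq v ->
  U [set k | u k <= v k] -> ulim u <= ulim v.
Proof.
move=> bu bv uv; apply: ler_cvg_to uv; exact: ulim_cvg.
Qed.

Lemma ultra_ge n : U [set k | (n <= k)%N].
Proof. by apply: oo_U; exists n. Qed.

End UltraLimit.

(** * Function algebras with a mean, and the maps preserving them *)

Section Means.
Context {R : realType}.

Record function_algebra (Y : Type) (D : set (Y -> R)) : Prop :=
  FunctionAlgebra {
  alg_bounded : forall f, D f -> exists C : R, forall y, `|f y| <= C;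
  alg_cst : forall c, D (fun=> c);
  algD : forall f g, D f -> D g -> D (fun y => f y + g y);
  algM : forall f g, D f -> D g -> D (fun y => f y * g y) }.

(** Only finite additivity is asked: unlike countable additivity, it passes to limits along an
    ultrafilter. *)
Record mean (Y : Type) (D : set (Y -> R)) (tau : (Y -> R) -> R) : Prop :=
  Mean {
  meanD : forall f g, D f -> D g ->
    tau (fun y => f y + g y) = tau f + tau g;
  meanZ : forall c f, D f -> tau (fun y => c * f y) = c * tau f;
  mean_ge0 : forall f, D f -> (forall y, 0 <= f y) -> 0 <= tau f;
  mean_cst1 : tau (fun=> 1) = 1 }.

Record preserves (Y : Type) (D : set (Y -> R)) (tau : (Y -> R) -> R)
    (T : Y -> Y) : Prop := Preserves {
  preserves_alg : forall f, D f -> D (fun y => f (T y));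
  preserves_mean : forall f, D f -> tau (fun y => f (T y)) = tau f }.

Section MeanTheory.
Context (Y : Type) (D : set (Y -> R)) (tau : (Y -> R) -> R).
Context (AD : function_algebra D) (Mtau : mean D tau).
Implicit Types f g : Y -> R.

Lemma algZ c f : D f -> D (fun y => c * f y).
Proof. by move=> Df; apply: (algM AD) => //; exact: alg_cst. Qed.

Lemma algB f g : D f -> D g -> D (fun y => f y - g y).
Proof.
move=> Df Dg; rewrite (_ : (fun _ => _) = fun y => f y + -1 * g y).
  by apply: (algD AD) => //; exact: algZ.
by apply/funext => y; rewrite mulN1r.
Qed.

Lemma alg_sqr f : D f -> D (fun y => f y ^+ 2).
Proof. by move=> Df; exact: (algM AD). Qed.

Lemma alg_sum (I : Type) (r : seq I) (P : pred I) (F : I -> Y -> R) :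
  (forall i, D (F i)) -> D (fun y => \sum_(i <- r | P i) F i y).
Proof.
move=> DF; elim: r => [|i r IH].
  by under eq_fun do rewrite big_nil; exact: alg_cst.
under eq_fun do rewrite big_cons; case: (P i) => //.
exact: (algD AD).
Qed.

Lemma alg_prod (I : Type) (r : seq I) (P : pred I) (F : I -> Y -> R) :
  (forall i, D (F i)) -> D (fun y => \prod_(i <- r | P i) F i y).
Proof.
move=> DF; elim: r => [|i r IH].
  by under eq_fun do rewrite big_nil; exact: alg_cst.
under eq_fun do rewrite big_cons; case: (P i) => //.
exact: (algM AD).
Qed.

Lemma mean_cst c : tau (fun=> c) = c.
Proof.
have /(meanZ Mtau c) := alg_cst AD 1; rewrite (mean_cst1 Mtau) mulr1 => E.
rewrite -[RHS]E.
by congr tau; apply/funext => y; rewrite mulr1.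
Qed.

Lemma meanB f g : D f -> D g -> tau (fun y => f y - g y) = tau f - tau g.
Proof.
move=> Df Dg; rewrite -[- tau g]mulN1r -(meanZ Mtau) // -(meanD Mtau) //.
  by congr tau; apply/funext => y; rewrite mulN1r.
exact: algZ.
Qed.

Lemma mean_le f g : D f -> D g -> (forall y, f y <= g y) -> tau f <= tau g.
Proof.
move=> Df Dg fg; rewrite -subr_ge0 -meanB //; apply: (mean_ge0 Mtau).
  exact: algB.
by move=> y; rewrite subr_ge0.
Qed.

Lemma mean_bounded C f : D f -> (forall y, `|f y| <= C) -> `|tau f| <= C.
Proof.
move=> Df fC; rewrite ler_norml; apply/andP; split.
  rewrite -[leLHS]mean_cst; apply: mean_le => //; first exact: alg_cst.
  by move=> y; have := fC y; rewrite ler_norml => /andP[].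
rewrite -[leRHS]mean_cst; apply: mean_le => //; first exact: alg_cst.
by move=> y; have := fC y; rewrite ler_norml => /andP[].
Qed.

Lemma mean_sum (I : Type) (r : seq I) (P : pred I) (F : I -> Y -> R) :
  (forall i, D (F i)) ->
  tau (fun y => \sum_(i <- r | P i) F i y) = \sum_(i <- r | P i) tau (F i).
Proof.
move=> DF; elim: r => [|i r IH].
  by under eq_fun do rewrite big_nil; rewrite mean_cst big_nil.
under eq_fun do rewrite big_cons; rewrite big_cons; case: (P i) => //.
by rewrite (meanD Mtau) ?IH//; exact: alg_sum.
Qed.

(** The difference of the two sides is the mean of (f - g)^2. This replaces the triangle inequality
    and avoids square roots of means. *)
Lemma mean_sqrD f g : D f -> D g ->
  tau (fun y => (f y + g y) ^+ 2) <=
  2 * tau (fun y => f y ^+ 2) + 2 * tau (fun y => g y ^+ 2).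
Proof.
move=> Df Dg; have [Df2 Dg2] := (alg_sqr Df, alg_sqr Dg).
rewrite -!(meanZ Mtau) // -(meanD Mtau); try exact: algZ.
apply: mean_le.
- by apply: alg_sqr; exact: (algD AD).
- by apply: (algD AD); exact: algZ.
- move=> y; rewrite -subr_ge0.
  by rewrite (_ : _ - _ = (f y - g y) ^+ 2) ?sqr_ge0 //; ring.
Qed.

Lemma preserves_alg_iter T f n : preserves D tau T -> D f ->
  D (fun y => f (iter n T y)).
Proof.
move=> pT; elim: n f => [//|n IH] f Df.
by apply: (IH (fun y => f (T y))); exact: (preserves_alg pT).
Qed.

Lemma preserves_mean_iter T f n : preserves D tau T -> D f ->
  tau (fun y => f (iter n T y)) = tau f.
Proof.
move=> pT; elim: n f => [//|n IH] f Df.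
rewrite -(preserves_mean pT Df) -[RHS](IH (fun y => f (T y))) //.
exact: (preserves_alg pT).
Qed.

End MeanTheory.

(** * Cauchy sequences for the quadratic seminorm of a mean *)

Definition cauchy_mean (Y : Type) (tau : (Y -> R) -> R) (u : nat -> Y -> R) :=
  forall e : R, 0 < e -> exists N0, forall M N, (N0 <= M)%N -> (N0 <= N)%N ->
    tau (fun y => (u M y - u N y) ^+ 2) <= e.

Section CauchyTheory.
Context (Y : Type) (D : set (Y -> R)) (tau : (Y -> R) -> R).
Context (AD : function_algebra D) (Mtau : mean D tau).
Implicit Types u v : nat -> Y -> R.

Lemma cauchy_meanD u v : (forall N, D (u N)) -> (forall N, D (v N)) ->
  cauchy_mean tau u -> cauchy_mean tau v ->
  cauchy_mean tau (fun N y => u N y + v N y).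
Proof.
move=> Du Dv cu cv e e0; have e4 : 0 < e / 4 by rewrite divr_gt0.
have [[M0 uM0] [N0 vN0]] := (cu _ e4, cv _ e4).
exists (maxn M0 N0) => M N; rewrite !geq_max => /andP[M1 M2] /andP[N1 N2].
rewrite (_ : (fun _ => _) =
  fun y => ((u M y - u N y) + (v M y - v N y)) ^+ 2); last first.
  by apply/funext => y; congr (_ ^+ 2); ring.
apply: (le_trans (mean_sqrD AD Mtau _ _)); try exact: (algB AD).
have := uM0 _ _ M1 N1; have := vN0 _ _ M2 N2; lra.
Qed.

Lemma cauchy_meanZ c u : (forall N, D (u N)) ->
  cauchy_mean tau u -> cauchy_mean tau (fun N y => c * u N y).
Proof.
(* The added 1 keeps the divisor positive when [c] is 0. *)
move=> Du cu e e0; have c1 : 0 < c ^+ 2 + 1 by rewrite ltr_wpDl ?sqr_ge0.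
have [N0 uN0] := cu (e / (c ^+ 2 + 1)) (divr_gt0 e0 c1).
exists N0 => M N NM NN.
rewrite (_ : (fun _ => _) = fun y => c ^+ 2 * (u M y - u N y) ^+ 2); last first.
  by apply/funext => y; ring.
rewrite (meanZ Mtau); last by apply: (alg_sqr AD); exact: (algB AD).
have {uN0}/(ler_wpM2l (sqr_ge0 c)) := uN0 _ _ NM NN.
move=> /le_trans; apply; rewrite mulrA ler_pdivrMr // mulrDr mulr1.
by rewrite mulrC lerDl ltW.
Qed.

(** The mean only gives a seminorm, so [v] may differ from [u] although all the distances vanish;
    the correction [v - u] is then trivially Cauchy. *)
Lemma cauchy_mean_near u v : (forall N, D (u N)) -> (forall N, D (v N)) ->
  (forall N, tau (fun y => (v N y - u N y) ^+ 2) <= 0) ->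
  cauchy_mean tau u -> cauchy_mean tau v.
Proof.
move=> Du Dv uv0 cu.
suff -> : v = fun N y => u N y + (v N y - u N y).
  apply: cauchy_meanD => //; first by move=> N; exact: (algB AD).
  move=> e e0; exists 0%N => M N _ _.
  rewrite (_ : (fun _ => _) = fun y =>
     ((v M y - u M y) + -1 * (v N y - u N y)) ^+ 2); last first.
    by apply/funext => y; congr (_ ^+ 2); ring.
  have DB K : D (fun y => v K y - u K y) by exact: (algB AD).
  apply: (le_trans (mean_sqrD AD Mtau _ _)) => //; first exact: (algZ AD).
  under [X in _ + 2 * tau X]eq_fun do rewrite mulN1r sqrrN.
  have := uv0 M; have := uv0 N; lra.
by apply/funext => N; apply/funext => y; rewrite addrC subrK.
Qed.

End CauchyTheory.

(** * Sequences of functions, averages and ultralimits of means *)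

Definition fiber_alg (Y : Type) (D : set (Y -> R)) : set (Y * nat -> R) :=
  [set g | (exists C : R, forall z, `|g z| <= C) /\
           forall k, D (fun y => g (y, k))].

Section Fibers.
Context (Y : Type) (D : set (Y -> R)) (AD : function_algebra D).

Lemma fiber_alg_algebra : function_algebra (fiber_alg D).
Proof.
split=> [f []//|c|f g [[A fA] Df] [[B gB] Dg]|f g [[A fA] Df] [[B gB] Dg]].
- by split=> [|k]; [exists (Num.norm c) | exact: (alg_cst AD)].
- split=> [|k]; last exact: (algD AD).
  by exists (A + B) => z; rewrite (le_trans (ler_normD _ _)) // lerD.
- split=> [|k]; last exact: (algM AD).
  by exists (A * B) => z; rewrite normrM ler_pM.
Qed.

Lemma fiber_mean tau k : mean D tau ->
  mean (fiber_alg D) (fun g => tau (fun y => g (y, k))).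
Proof.
move=> Mt; split.
- by move=> f g [_ Df] [_ Dg]; rewrite (meanD Mt).
- by move=> c f [_ Df]; rewrite (meanZ Mt).
- by move=> f [_ Df] f0; apply: (mean_ge0 Mt).
- by rewrite (mean_cst1 Mt).
Qed.

Lemma fiber_alg_fst f : D f -> fiber_alg D (fun z => f z.1).
Proof.
by move=> Df; split=> //; have [C fC] := alg_bounded AD Df; exists C => z.
Qed.

Lemma preserves_fiber tau T k : preserves D tau T ->
  preserves (fiber_alg D) (fun g => tau (fun y => g (y, k)))
    (fun z => (T z.1, z.2)).
Proof.
move=> pT; split=> [f [[C fC] Df]|f [_ Df]] /=.
  by split=> [|j]; [exists C => z|exact: (preserves_alg pT (Df j))].
exact: (preserves_mean pT (Df k)).
Qed.

End Fibers.

Section Averages.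
Context (Y : Type) (D : set (Y -> R)) (AD : function_algebra D).

Lemma average_mean (K : nat) (t : nat -> (Y -> R) -> R) :
  (forall n, mean D (t n)) ->
  mean D (fun f => K.+1%:R^-1 * \sum_(n < K.+1) t n f).
Proof.
move=> Mt; split.
- move=> f g Df Dg; rewrite -mulrDr -big_split /=; congr (_ * _).
  by apply: eq_bigr => n _; rewrite (meanD (Mt n)).
- move=> c f Df; rewrite mulrCA; congr (_ * _); rewrite mulr_sumr.
  by apply: eq_bigr => n _; rewrite (meanZ (Mt n)).
- move=> f Df f0; rewrite mulr_ge0 ?invr_ge0 // sumr_ge0 // => n _.
  by rewrite (mean_ge0 (Mt n)).
- rewrite (eq_bigr (fun=> 1)) => [|n _]; last by rewrite (mean_cst1 (Mt n)).
  by rewrite sumr_const card_ord mulVf // pnatr_eq0.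
Qed.

Lemma preserves_average (K : nat) (t : nat -> (Y -> R) -> R) T :
  (forall n, preserves D (t n) T) ->
  preserves D (fun f => K.+1%:R^-1 * \sum_(n < K.+1) t n f) T.
Proof.
move=> pT; split=> f Df; first exact: (preserves_alg (pT 0%N)).
by congr (_ * _); apply: eq_bigr => n _; rewrite (preserves_mean (pT n)).
Qed.

Context (U : set_system nat) {UU : UltraFilter U}.

Lemma mean_bounded_seq (t : nat -> (Y -> R) -> R) f :
  (forall n, mean D (t n)) -> D f -> bounded_seq (fun k => t k f).
Proof.
move=> Mt Df; have [C fC] := alg_bounded AD Df.
by exists C => k; exact: (mean_bounded AD).
Qed.

(** A mean of [f] obeys every bound on |f|, so the sequences are bounded and their ultralimits
    additive. Applied to the fibre means, this gives the mean of an ultraproduct. *)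
Lemma ulim_mean (t : nat -> (Y -> R) -> R) :
  (forall n, mean D (t n)) -> mean D (fun f => ulim U (fun k => t k f)).
Proof.
move=> Mt; split.
- move=> f g Df Dg; rewrite -ulimD; try exact: mean_bounded_seq.
  by congr ulim; apply/funext => k; rewrite (meanD (Mt k)).
- move=> c f Df; rewrite -ulimZ; last exact: mean_bounded_seq.
  by congr ulim; apply/funext => k; rewrite (meanZ (Mt k)).
- move=> f Df f0; apply: ulim_ge; first exact: mean_bounded_seq.
  by apply: filterS filterT => k _ /=; exact: (mean_ge0 (Mt k)).
- rewrite -[RHS](@ulim_cst _ U); congr ulim.
  by apply/funext => k; rewrite (mean_cst1 (Mt k)).
Qed.

Lemma preserves_ulim (t : nat -> (Y -> R) -> R) T :
  (forall n, preserves D (t n) T) ->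
  preserves D (fun f => ulim U (fun k => t k f)) T.
Proof.
move=> pT; split=> f Df; first exact: (preserves_alg (pT 0%N)).
by congr ulim; apply/funext => k; rewrite (preserves_mean (pT k)).
Qed.

End Averages.

End Means.

(** * Inequalities for finite averages *)

Section FiniteAverages.
Context {R : realType}.

(** Nonnegativity of the variance of the values about their average [m]. *)
Lemma sqr_average_le (K : nat) (x : nat -> R) :
  (K.+1%:R^-1 * \sum_(n < K.+1) x n) ^+ 2 <=
  K.+1%:R^-1 * \sum_(n < K.+1) x n ^+ 2.
Proof.
set m := K.+1%:R^-1 * _.
have K0 : K.+1%:R != 0 :> R by rewrite pnatr_eq0.
have Km : \sum_(n < K.+1) x n = K.+1%:R * m by rewrite mulrA divff // mul1r.
have : 0 <= \sum_(n < K.+1) (x n - m) ^+ 2.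
  by rewrite sumr_ge0 // => n _; exact: sqr_ge0.
rewrite (eq_bigr (fun n : 'I_K.+1 => x n ^+ 2 + (- 2 * m * x n + m ^+ 2)));
  last by move=> n _; ring.
rewrite 2!big_split /= -mulr_sumr Km sumr_const card_ord -[m ^+ 2 *+ _]mulr_natl.
rewrite (_ : _ + (_ + _) = \sum_(n < K.+1) x n ^+ 2 - K.+1%:R * m ^+ 2);
  last by ring.
by rewrite subr_ge0 => ?; rewrite ler_pdivlMl // ltr0n.
Qed.

(** Each unit shift of the window trades one term for another and costs at most 2B. *)
Lemma average_shift_le (K m : nat) (b : nat -> R) (B : R) :
  (forall j, `|b j| <= B) ->
  `|K.+1%:R^-1 * \sum_(n < K.+1) b n - K.+1%:R^-1 * \sum_(n < K.+1) b (n + m)%N|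
    <= K.+1%:R^-1 * (m%:R * (2 * B)).
Proof.
move=> bB; rewrite -mulrBr normrM ger0_norm ?invr_ge0 //.
rewrite ler_wpM2l ?invr_ge0 //.
elim: m => [|m IH].
  under [X in _ - X]eq_bigr do rewrite addn0.
  by rewrite subrr normr0 mul0r.
rewrite (_ : _ - _ = (\sum_(n < K.+1) b n - \sum_(n < K.+1) b (n + m)%N) +
    (b m - b (K.+1 + m)%N)); last first.
  rewrite -addrA; congr (_ + _); rewrite big_ord_recr [in RHS]big_ord_recl /=.
  rewrite add0n (eq_bigr (fun i : 'I_K => b (bump 0 i + m)%N)); last first.
    by move=> i _; rewrite addnS -addSn.
  by rewrite addnS addSn; ring.
apply: (le_trans (ler_normD _ _)); rewrite -[m.+1%:R]natr1 mulrDl mul1r lerD //.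
apply: (le_trans (ler_normB _ _)); have := bB m; have := bB (K.+1 + m)%N; lra.
Qed.

Lemma average_norm_le (M : nat) (b : nat -> R) (B : R) : 0 <= B ->
  (forall n, (n < M)%N -> `|b n| <= B) ->
  `|M%:R^-1 * \sum_(n < M) b n| <= B.
Proof.
move=> B0 bB; case: M bB => [|M] bB; first by rewrite big_ord0 mulr0 normr0.
rewrite normrM ger0_norm ?invr_ge0 // ler_pdivrMl ?ltr0n //.
apply: (le_trans (ler_norm_sum _ _ _)).
apply: (@le_trans _ _ (\sum_(i < M.+1) B)).
  by apply: ler_sum => i _; exact: bB.
by rewrite sumr_const card_ord mulr_natl.
Qed.

End FiniteAverages.

(** * Multiple averages in abstract systems *)

Section MultipleAverages.
Context {R : realType}.

(** Families are indexed by [nat], so that the induction on [l] keeps [T] and [f] unchanged. *)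
Definition multiple_average (Y : Type) (l : nat) (T : nat -> Y -> Y)
    (f : nat -> Y -> R) (N : nat) (y : Y) : R :=
  N%:R^-1 * \sum_(n < N) \prod_(i < l) f i (iter n (T i) y).

(** The claim ranges over all systems because the step to [l.+1] on [Y] uses the case [l] on
    [Y * nat] with a different mean. *)
Definition multiple_averages_cauchy (l : nat) : Prop :=
  forall (Y : Type) (D : set (Y -> R)) (tau : (Y -> R) -> R)
    (T S : nat -> Y -> Y) (f : nat -> Y -> R),
  function_algebra D -> mean D tau ->
  (forall i, preserves D tau (T i)) -> (forall i, preserves D tau (S i)) ->
  (forall i, cancel (T i) (S i)) -> (forall i, cancel (S i) (T i)) ->
  (forall i j y, T i (T j y) = T j (T i y)) ->
  (forall i, D (f i)) ->
  cauchy_mean tau (multiple_average l T f).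

Lemma iter_comm (Y : Type) (A B : Y -> Y) m n y :
  (forall y, A (B y) = B (A y)) -> iter m A (iter n B y) = iter n B (iter m A y).
Proof.
move=> AB; elim: m => [//|m IH]; rewrite iterS IH /=.
by elim: n {IH} => [//|n IH] /=; rewrite AB IH.
Qed.

Lemma iter_cancel (Y : Type) (A B : Y -> Y) n :
  cancel A B -> cancel (iter n A) (iter n B).
Proof.
move=> AB; elim: n => [//|n IH] y.
by rewrite iterSr /= AB IH.
Qed.

Lemma iter_fst (Y : Type) (T : Y -> Y) n (z : Y * nat) :
  iter n (fun z => (T z.1, z.2)) z = (iter n T z.1, z.2).
Proof. by elim: n => [|n IH] /=; [case: z|rewrite IH]. Qed.

(** * Induction step: the ultraproduct system and the space V *)

Section InductionStep.
Context (l : nat) (IHl : multiple_averages_cauchy l).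
Context (Y : Type) (D : set (Y -> R)) (tau : (Y -> R) -> R).
Context (T S : nat -> Y -> Y) (f : nat -> Y -> R).
Context (AD : function_algebra D) (Mt : mean D tau).
Context (pT : forall i, preserves D tau (T i)).
Context (pS : forall i, preserves D tau (S i)).
Context (TK : forall i, cancel (T i) (S i)) (SK : forall i, cancel (S i) (T i)).
Context (TC : forall i j y, T i (T j y) = T j (T i y)).
Context (Df : forall i, D (f i)).
Context (U : set_system nat) {UU : UltraFilter U} (oo_U : \oo `<=` U).

Let D1 := fiber_alg D.
(** The mean of the ultraproduct along [U]: the second coordinate is the index of the sequence, and
    sequences that agree for [U]-almost all indices are at distance 0. *)
Let t1 (g : Y * nat -> R) := ulim U (fun k => tau (fun y => g (y, k))).
Let P := T l.
Let Q := S l.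
Let p n y := \prod_(i < l) f i (iter n (T i) y).

Let AD1 : function_algebra D1. Proof. exact: fiber_alg_algebra. Qed.

Let M1 : mean D1 t1.
Proof.
by apply: (ulim_mean AD1 (t := fun k g => tau (fun y => g (y, k)))) => k;
  exact: fiber_mean.
Qed.

Let t1_bounded g : D1 g -> bounded_seq (fun k => tau (fun y => g (y, k))).
Proof.
move=> Dg; apply: (mean_bounded_seq AD1
  (t := fun k g => tau (fun y => g (y, k)))) => // k; exact: fiber_mean.
Qed.

Let p_bounded : exists2 B : R, 0 <= B & forall n y, `|p n y| <= B.
Proof.
have : forall i, exists C : R, forall y, `|f i y| <= C.
  by move=> i; exact: (alg_bounded AD).
move=> /choice[C fC].
have C0 i (y : Y) : 0 <= C i by rewrite (le_trans _ (fC i y)).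
(* The bounds [C i] are known to be nonnegative only when [Y] has a point. *)
have [[y0]|noY] := pselect (inhabited Y); last first.
  by exists 0 => // n y; exfalso; apply: noY; exists.
exists (\prod_(i < l) C i) => [|n y].
  by apply: prodr_ge0 => i _; exact: C0.
by rewrite normr_prod ler_prod // => i _; rewrite normr_ge0 fC.
Qed.

Let Dp n : D (p n).
Proof. by apply: (alg_prod AD) => i; exact: (preserves_alg_iter n (pT i)). Qed.

(** The average of [l.+1] functions with the sequence [g] as the last one, taken in each fibre
    separately. *)
Definition step_average M (g : Y * nat -> R) (z : Y * nat) : R :=
  M%:R^-1 * \sum_(m < M) (p m z.1 * g (iter m P z.1, z.2)).

Let D_step M g k : D (fun y => g (y, k)) ->
  D (fun y => step_average M g (y, k)).
Proof.
move=> Dg; apply: (algZ AD); apply: (alg_sum AD) => m.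
by apply: (algM AD) => //; exact: (preserves_alg_iter m (pT l) Dg).
Qed.

Let step_bounded B H M g z : (forall n y, `|p n y| <= B) ->
  (forall z, `|g z| <= H) -> `|step_average M g z| <= B * H.
Proof.
move=> pB gH.
have [B0 H0] : 0 <= B /\ 0 <= H.
  by rewrite (le_trans _ (pB 0%N z.1)) // (le_trans _ (gH z)).
apply: (average_norm_le
  (b := fun m => p m z.1 * g (iter m P z.1, z.2))) => [|n _].
  exact: mulr_ge0.
by rewrite normrM ler_pM.
Qed.

Let D1_step M g : D1 g -> D1 (step_average M g).
Proof.
move=> [[H gH] Dg]; have [B B0 pB] := p_bounded; split=> [|k].
  by exists (B * H) => z; exact: step_bounded.
exact: D_step.
Qed.

Let step_linear M a g h z :
  step_average M (fun z => g z + a * h z) z =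
  step_average M g z + a * step_average M h z.
Proof.
rewrite /step_average (mulrCA a) -mulrDr [a * _]mulr_sumr -big_split /=; congr (_ * _).
by apply: eq_bigr => m _; ring.
Qed.

(** The space V, made of sequences rather than of classes modulo [U]. *)
Definition step_cauchy : set (Y * nat -> R) :=
  [set g | D1 g /\ cauchy_mean t1 (fun M => step_average M g)].

Lemma step_cauchy_linear a g h : step_cauchy g -> step_cauchy h ->
  step_cauchy (fun z => g z + a * h z).
Proof.
move=> [Dg cg] [Dh ch]; split.
  by apply: (algD AD1) => //; exact: (algZ AD1).
rewrite (_ : (fun M => _) =
  fun M z => step_average M g z + a * step_average M h z); last first.
  by apply/funext => M; apply/funext => z; exact: step_linear.
apply: (cauchy_meanD AD1 M1) => //.
- by move=> N; exact: D1_step.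
- by move=> N; apply: (algZ AD1); exact: D1_step.
- by apply: (cauchy_meanZ AD1 M1) => // N; exact: D1_step.
Qed.

Lemma step_cauchy0 : step_cauchy (fun=> 0).
Proof.
split; first exact: (alg_cst AD1).
move=> e e0; exists 0%N => M N _ _.
have av0 K z : step_average K (fun=> 0) z = 0.
  by rewrite /step_average big1 ?mulr0 // => m _; rewrite mulr0.
rewrite (_ : (fun _ => _) = fun=> 0); last first.
  by apply/funext => z; rewrite !av0 subrr expr0n.
by rewrite (mean_cst AD1 M1) ltW.
Qed.

(** The window has K k + 1 points in fibre k, hence is never empty; when [K] tends to infinity along
    [U], it is an infinite window of the ultraproduct. *)
Definition dual_function (K : nat -> nat) (a : Y * nat -> R) (z : Y * nat) : R :=
  (K z.2).+1%:R^-1 * \sum_(n < (K z.2).+1)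
    (a (iter n Q z.1, z.2) * p n (iter n Q z.1)).

Let D_iterQ n g : D g -> D (fun y => g (iter n Q y)).
Proof. exact: (preserves_alg_iter n (pS l)). Qed.

Let D1_dual K a : D1 a -> D1 (dual_function K a).
Proof.
move=> [[A aA] Da]; have [B B0 pB] := p_bounded; split=> [|k].
  exists (A * B) => z; have A0 : 0 <= A by rewrite (le_trans _ (aA z)).
  apply: (average_norm_le
    (b := fun n => a (iter n Q z.1, z.2) * p n (iter n Q z.1))) => [|n _].
    exact: mulr_ge0.
  by rewrite normrM ler_pM.
rewrite /dual_function /=; apply: (algZ AD); apply: (alg_sum AD) => n.
by apply: (algM AD); [exact: (D_iterQ n (Da k))|exact: (D_iterQ n (Dp n))].
Qed.

(** With n = [z.2], the product p_m(y) p_(n+m)(Q^n y) is the product over i < l of the F_i at (T_i^m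
    y, n), because [Q] commutes with [T i]. Here the second coordinate is a time in the window, not
    the index of a sequence. *)
Let F i (z : Y * nat) := f i z.1 * f i (iter z.2 (T i) (iter z.2 Q z.1)).

Let T1 i (z : Y * nat) := (T i z.1, z.2).

Let u M := multiple_average l T1 F M.

Let QT i y : Q (T i y) = T i (Q y).
Proof. by rewrite -[y in LHS](SK l) -[T i _]TC [LHS]TK. Qed.

Let F_iter i m n y : F i (iter m (T1 i) (y, n)) =
  f i (iter m (T i) y) * f i (iter (n + m) (T i) (iter n Q y)).
Proof.
rewrite /T1 iter_fst /F /=; congr (_ * f i _).
rewrite (@iter_comm _ Q (T i)) => [|x]; last exact: QT.
by rewrite -iterD.
Qed.

(* [step_average M (dual_function K a)] up to the boundary effect of shifting
   the window [n < K k] by [m < M]: the powers of [T l] have disappeared, and the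
   second coordinate of the argument of [u] is [n]. *)
Definition dual_limit K a M (z : Y * nat) : R :=
  (K z.2).+1%:R^-1 * \sum_(n < (K z.2).+1) (a (iter n Q z.1, z.2) * u M (z.1, n : nat)).

Let D1F i : D1 (F i).
Proof.
have [C fC] := alg_bounded AD (Df i); split=> [|k].
  exists (C * C) => z; have C0 : 0 <= C by rewrite (le_trans _ (fC z.1)).
  by rewrite normrM ler_pM.
rewrite /F /=; apply: (algM AD) => //.
by apply: (D_iterQ k (g := fun y => f i (iter k (T i) y)));
   exact: (preserves_alg_iter k (pT i)).
Qed.

Let D1u M : D1 (u M).
Proof.
apply: (algZ AD1); apply: (alg_sum AD1) => n; apply: (alg_prod AD1) => i.
suff -> : (fun z => F i (iter n (T1 i) z)) =
    fun z : Y * nat => f i (iter n (T i) z.1) *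
       f i (iter z.2 (T i) (iter n (T i) (iter z.2 Q z.1))).
  have [C fC] := alg_bounded AD (Df i); split=> [|k].
    exists (C * C) => z; have C0 : 0 <= C by rewrite (le_trans _ (fC z.1)).
    by rewrite normrM ler_pM.
  rewrite /=; apply: (algM AD); first exact: (preserves_alg_iter n (pT i)).
  apply: (D_iterQ k (g := fun y => f i (iter k (T i) (iter n (T i) y)))).
  apply: (preserves_alg_iter n (pT i) (f := fun y => f i (iter k (T i) y))).
  exact: (preserves_alg_iter k (pT i)).
by apply/funext => -[y k]; rewrite F_iter /= iterD.
Qed.

Let u_bounded M : exists C : R, forall z, `|u M z| <= C.
Proof. exact: (alg_bounded AD1). Qed.

(** * Dual functions over infinite windows lie in V *)

Section DualStepCauchy.
Context (K : nat -> nat) (K_oo : forall m, U [set k | (m <= K k)%N]).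
Context (a : Y * nat -> R) (D1a : D1 a).

(** The mean for which the second coordinate is a time uniformly distributed over the window
    [0, K k], in the limit of k along [U]. *)
Let t2 (g : Y * nat -> R) := ulim U (fun k =>
  (K k).+1%:R^-1 * \sum_(n < (K k).+1) tau (fun y => g (y, n : nat))).

Let mean_t2k k : mean D1 (fun g =>
  (K k).+1%:R^-1 * \sum_(n < (K k).+1) tau (fun y => g (y, n : nat))).
Proof.
apply: (average_mean (K k) (t := fun n g => tau (fun y => g (y, n)))) => n.
exact: fiber_mean.
Qed.

Let M2 : mean D1 t2.
Proof.
exact: (ulim_mean AD1 (t := fun k g =>
  (K k).+1%:R^-1 * \sum_(n < (K k).+1) tau (fun y => g (y, n : nat)))).
Qed.

(** The induction hypothesis on [Y * nat] with the mean [t2]: maps acting on the first coordinate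
    alone preserve every fibre mean, hence [t2]. *)
Let u_cauchy : cauchy_mean t2 u.
Proof.
have pres V : preserves D tau V -> preserves D1 t2 (fun z => (V z.1, z.2)).
  move=> pV; apply: (preserves_ulim U (t := fun k g =>
    (K k).+1%:R^-1 * \sum_(n < (K k).+1) tau (fun y => g (y, n : nat)))) => k.
  apply: (preserves_average (K k) (t := fun n g => tau (fun y => g (y, n)))) => n.
  exact: preserves_fiber.
apply: (IHl (S := fun i z => (S i z.1, z.2)) AD1 M2 _ _ _ _ _ D1F).
- by move=> i; exact: pres.
- by move=> i; exact: pres.
- by move=> i [y k]; rewrite /T1 /= TK.
- by move=> i [y k]; rewrite /T1 /= SK.
- by move=> i j [y k]; rewrite /T1 /= TC.
Qed.

Let D1_dual_limit M : D1 (dual_limit K a M).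
Proof.
have [[A aA] Da] := D1a; have [C uC] := u_bounded M; split=> [|k].
  exists (A * C) => z.
  have [A0 C0] : 0 <= A /\ 0 <= C.
    by rewrite (le_trans _ (aA z)) // (le_trans _ (uC z)).
  apply: (average_norm_le
    (b := fun n => a (iter n Q z.1, z.2) * u M (z.1, n))) => [|n _].
    exact: mulr_ge0.
  by rewrite normrM ler_pM.
rewrite /dual_limit /=; apply: (algZ AD); apply: (alg_sum AD) => n.
apply: (algM AD); first exact: (D_iterQ n (Da k)).
by have [_] := D1u M; apply.
Qed.

(** By [sqr_average_le] on each window, the squared distance for [t1] is at most A^2 times that of
    the [u] for [t2]; A^2 + 1 is used to have a positive constant. *)
Let dual_limit_cauchy : cauchy_mean t1 (dual_limit K a).
Proof.
move=> e e0; have [[A aA] Da] := D1a.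
have A1 : 0 < A ^+ 2 + 1 by rewrite ltr_wpDl ?sqr_ge0.
have [N0 uN0] := u_cauchy (divr_gt0 e0 A1).
exists N0 => M N NM NN; have {uN0} := uN0 _ _ NM NN.
rewrite ler_pdivlMr //; apply: le_trans.
have Duu : D1 (fun z => (u M z - u N z) ^+ 2).
  by apply: (alg_sqr AD1); exact: (algB AD1).
rewrite mulrC -(meanZ M2) //.
apply: ulim_eventually_le.
- exact: (t1_bounded
    (alg_sqr AD1 (algB AD1 (D1_dual_limit M) (D1_dual_limit N)))).
- exact: (mean_bounded_seq AD1 mean_t2k (algZ AD1 (A ^+ 2 + 1) Duu)).
apply: filterS filterT => k _ /=.
pose v n y : R := (A ^+ 2 + 1) * (u M (y, n) - u N (y, n)) ^+ 2.
have Dv n : D (v n) by have [_ /(_ n)] := algZ AD1 (A ^+ 2 + 1) Duu.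
rewrite -(mean_sum AD Mt _ _ (F := fun n : 'I_(K k).+1 => v n)) //.
rewrite -(meanZ Mt); last exact: (alg_sum AD).
apply: (mean_le AD Mt).
- have [_] := alg_sqr AD1 (algB AD1 (D1_dual_limit M) (D1_dual_limit N)).
  by apply.
- by apply: (algZ AD); exact: (alg_sum AD).
move=> y; rewrite /dual_limit /= -mulrBr -sumrB.
under [X in (_ * X) ^+ 2]eq_bigr do rewrite -mulrBr.
apply: (le_trans (sqr_average_le (K k)
  (fun n => a (iter n Q y, k) * (u M (y, n) - u N (y, n))))).
rewrite ler_wpM2l ?invr_ge0 //; apply: ler_sum => n _.
rewrite exprMn /v ler_wpM2r ?sqr_ge0 //.
have aA2 : a (iter n Q y, k) ^+ 2 <= A ^+ 2.
  by rewrite -[leLHS]real_normK ?num_real // ler_sqr ?nnegrE // (le_trans _ (aA (y, k))).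
by rewrite (le_trans aA2) // lerDl.
Qed.

(** Shifting the window by m < M moves an average of terms bounded by |A|B by at most 2m|A|B / (K k
    + 1), and [p m] adds a factor B. The constant depends on M but not on the fibre k. *)
Let step_dual_near M : exists2 C : R, 0 <= C & forall y k,
  `|step_average M (dual_function K a) (y, k) - dual_limit K a M (y, k)| <=
  (K k).+1%:R^-1 * C.
Proof.
have [[A aA] Da] := D1a; have [B B0 pB] := p_bounded.
have A0 : 0 <= `|A| by [].
have {}aA z : `|a z| <= `|A| by rewrite (le_trans (aA z)) // ler_norm.
exists (B * (M%:R * (2 * (`|A| * B)))) => [|y k].
  by rewrite !mulr_ge0.
pose b m j := a (iter j Q (iter m P y), k) * p j (iter j Q (iter m P y)).
have bAB m j : `|b m j| <= `|A| * B by rewrite normrM ler_pM.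
(* In [b m (n + m)] the powers Q^m and P^m cancel; exchanging the sums over m and n then recovers
   [dual_limit]. *)
have -> : dual_limit K a M (y, k) = M%:R^-1 * \sum_(m < M) (p m y *
    ((K k).+1%:R^-1 * \sum_(n < (K k).+1) b m (n + m)%N)).
  rewrite /dual_limit /= /u /multiple_average.
  under [X in _ * X = _]eq_bigr do rewrite mulrCA.
  rewrite -mulr_sumr mulrCA; congr (_ * _).
  under [X in _ * X = _]eq_bigr do rewrite mulr_sumr.
  rewrite exchange_big /= mulr_sumr; apply: eq_bigr => m _.
  rewrite mulrCA; congr (_ * _); rewrite mulr_sumr; apply: eq_bigr => n _.
  under eq_bigr do rewrite F_iter.
  rewrite big_split /= mulrCA; congr (_ * _).
  by rewrite /b iterD (iter_cancel m (TK l)).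
rewrite /step_average /= -mulrBr -sumrB.
under eq_bigr do rewrite -mulrBr.
apply: (average_norm_le (b := fun m => p m y * (dual_function K a (iter m P y, k) -
  (K k).+1%:R^-1 * \sum_(n < (K k).+1) b m (n + m)%N))) => [|m mM].
  by rewrite !mulr_ge0 ?invr_ge0.
rewrite normrM mulrCA ler_pM //.
apply: (le_trans (average_shift_le (K k) m (bAB m))).
by rewrite ler_wpM2l ?invr_ge0 // ler_wpM2r ?mulr_ge0 // ler_nat ltnW.
Qed.

(** For fixed N the distance to [dual_limit] is O(1 / (K k + 1)) in fibre k. This vanishes along
    [U], so the two averages are at distance 0 for [t1]. *)
Lemma dual_step_cauchy : step_cauchy (dual_function K a).
Proof.
split; first exact: D1_dual.
apply: (cauchy_mean_near AD1 M1 _ _ _ dual_limit_cauchy) => //.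
  by move=> N; apply: D1_step; exact: D1_dual.
move=> N; have [C C0 nearC] := step_dual_near N.
have Dd : D1 (fun z => (step_average N (dual_function K a) z -
    dual_limit K a N z) ^+ 2).
  by apply: (alg_sqr AD1); apply: (algB AD1) => //; apply: D1_step; exact: D1_dual.
apply/ler_addgt0Pl => e e0; rewrite addr0.
apply: ulim_le; first exact: (t1_bounded Dd).
(* For K k >= m one has (K k + 1)^2 >= K k + 1 >= m > C^2 / e. *)
pose m := (Num.truncn (C ^+ 2 / e)).+1.
apply: filterS (K_oo m) => k /= mK.
rewrite -[leRHS](mean_cst AD Mt); apply: (mean_le AD Mt).
- by have [_] := Dd; apply.
- exact: (alg_cst AD).
move=> y; rewrite -[leLHS]real_normK ?num_real //.
have K1 : 1 <= (K k).+1%:R :> R by rewrite ler1n.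
apply: (@le_trans _ _ (((K k).+1%:R^-1 * C) ^+ 2)).
  by rewrite ler_sqr ?nnegrE // mulr_ge0 ?invr_ge0.
rewrite exprMn exprVn ler_pdivrMl ?exprn_gt0 // -ler_pdivrMr //.
apply: (@le_trans _ _ m%:R); first by rewrite ltW // truncnS_gt.
apply: (@le_trans _ _ (K k).+1%:R); first by rewrite ler_nat leqW.
by rewrite expr2 ler_peMl.
Qed.

End DualStepCauchy.

(** * Sequences almost orthogonal to V have small averages *)

Let p_sqr_bound : exists2 C : R, 0 < C & forall n y, p n y ^+ 2 <= C.
Proof.
have [B B0 pB] := p_bounded; exists (B ^+ 2 + 1).
  by rewrite ltr_wpDl ?sqr_ge0.
move=> n y; rewrite -[leLHS]real_normK ?num_real //.
by rewrite (@le_trans _ _ (B ^+ 2)) ?lerDl // ler_sqr ?nnegrE.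
Qed.

Let slice1 g k : D1 g -> D (fun y => g (y, k)).
Proof. by case. Qed.

(* The factor [h] of the average, transported by [Q], is paired with the dual
   function; invariance of [tau] moves [Q] back onto [h]. *)
Let dual_pairing K a h k : D1 a -> D1 h ->
  (forall y, a (y, k) = step_average (K k).+1 h (y, k)) ->
  tau (fun y => h (y, k) * dual_function K a (y, k)) =
  tau (fun y => a (y, k) ^+ 2).
Proof.
move=> D1a D1h ah; have [Da Dh] := (slice1 k D1a, slice1 k D1h).
pose c : R := (K k).+1%:R^-1.
pose phi n y := h (y, k) * (a (iter n Q y, k) * p n (iter n Q y)).
have Dphi n : D (phi n).
  by apply: (algM AD) => //; apply: (algM AD);
    [exact: (D_iterQ n Da)|exact: (D_iterQ n (Dp n))].
rewrite (_ : (fun _ => _) = fun y => c * \sum_(n < (K k).+1) phi n y); last first.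
  by apply/funext => y; rewrite /dual_function /= mulrCA mulr_sumr.
rewrite (meanZ Mt); last exact: (alg_sum AD).
rewrite (mean_sum AD Mt _ _ (F := fun n : 'I_(K k).+1 => phi n)) //.
pose psi n y := a (y, k) * (p n y * h (iter n P y, k)).
have Dpsi n : D (psi n).
  apply: (algM AD) => //; apply: (algM AD) => //.
  exact: (preserves_alg_iter n (pT l) Dh).
rewrite (eq_bigr (fun n : 'I_(K k).+1 => tau (psi n))); last first.
  move=> n _; rewrite -(preserves_mean_iter n (pT l) (Dphi n)).
  congr tau; apply/funext => y; rewrite /phi /psi (iter_cancel n (TK l)).
  by rewrite mulrC mulrA.
rewrite -(mean_sum AD Mt _ _ (F := fun n : 'I_(K k).+1 => psi n)) //.
rewrite -(meanZ Mt); last exact: (alg_sum AD).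
congr tau; apply/funext => y; rewrite expr2 {2}ah /step_average /=.
by rewrite /psi -mulr_sumr mulrCA.
Qed.

(** Cauchy-Schwarz over the window and the bound on [p]; by invariance under [Q] every term then has
    the same mean. *)
Let dual_sqr_le C K a k : (forall n y, p n y ^+ 2 <= C) -> D1 a ->
  tau (fun y => dual_function K a (y, k) ^+ 2) <=
  C * tau (fun y => a (y, k) ^+ 2).
Proof.
move=> pC D1a; have Da := slice1 k D1a.
pose c : R := (K k).+1%:R^-1.
have c0 : 0 <= c by rewrite invr_ge0.
pose phi n y := C * a (iter n Q y, k) ^+ 2.
have Dphi n : D (phi n).
  by apply: (algZ AD); apply: (alg_sqr AD); exact: (D_iterQ n Da).
apply: (@le_trans _ _ (tau (fun y => c * \sum_(n < (K k).+1) phi n y))).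
  apply: (mean_le AD Mt).
  - exact: (alg_sqr AD (slice1 k (D1_dual K D1a))).
  - by apply: (algZ AD); exact: (alg_sum AD).
  move=> y; apply: (le_trans (sqr_average_le (K k)
    (fun n => a (iter n Q y, k) * p n (iter n Q y)))).
  rewrite ler_wpM2l //; apply: ler_sum => n _.
  by rewrite exprMn mulrC ler_wpM2r ?sqr_ge0.
rewrite (meanZ Mt); last exact: (alg_sum AD).
rewrite (mean_sum AD Mt _ _ (F := fun n : 'I_(K k).+1 => phi n)) //.
rewrite (eq_bigr (fun=> C * tau (fun y => a (y, k) ^+ 2))); last first.
  move=> n _; rewrite (meanZ Mt); last first.
    by apply: (alg_sqr AD); exact: (D_iterQ n Da).
  congr (_ * _).
  by rewrite -[RHS](preserves_mean_iter n (pS l) (alg_sqr AD Da)).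
by rewrite sumr_const card_ord -[X in c * X]mulr_natl mulKf ?pnatr_eq0.
Qed.

(* If the averages of [h] were large infinitely often, taking for [K k] the last
   bad time up to [k] would make [K] infinite along [U] and produce a dual
   function correlating with [h]. *)
Let almost_orthogonal_small C eta h : 0 < C -> 0 < eta ->
  (forall n y, p n y ^+ 2 <= C) -> D1 h ->
  (forall s c, step_cauchy s ->
     t1 (fun z => h z ^+ 2) <= t1 (fun z => (h z - c * s z) ^+ 2) + eta) ->
  exists M0, forall M, (M0 <= M)%N ->
    t1 (fun z => step_average M h z ^+ 2) <= 2 * C * eta.
Proof.
move=> C0 eta0 pC D1h horth; apply: contrapT => nsmall.
set th := 2 * C * eta in nsmall.
have th0 : 0 < th by rewrite !mulr_gt0.
have Dav M : D1 (step_average M h) by exact: D1_step.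
have bad M0 : exists2 M, (M0 <= M)%N & th < t1 (fun z => step_average M h z ^+ 2).
  apply: contrapT => nb; apply: nsmall; exists M0 => M M0M.
  by rewrite leNgt; apply/negP => ?; apply: nb; exists M.
(* Bad times of fibre k are cut off at k, so that there is a last one, [m k]; it is 0 if there is
   none. *)
pose b k (M : 'I_k.+1) := th < tau (fun y => step_average M h (y, k) ^+ 2).
pose m k := \max_(M in b k) (M : nat).
(* An average over no terms is 0, so a bad time is positive and can be written K k + 1. *)
have b0 k (M : 'I_k.+1) : M \in b k -> (0 < M)%N.
  rewrite lt0n; apply: contraTN => /eqP M0; rewrite unfold_in /b M0 -leNgt.
  rewrite (_ : (fun _ => _) = fun=> 0) ?(mean_cst AD Mt) ?ltW //.
  by apply/funext => y; rewrite /step_average big_ord0 mulr0 expr0n.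
(* Some M >= M0 is bad in the ultralimit, hence in [U]-almost every fibre, where the last bad time
   is then at least M. *)
have Ubad M0 : U [set k | [/\ (M0 <= m k)%N, (0 < m k)%N &
    th < tau (fun y => step_average (m k) h (y, k) ^+ 2)]].
  have [M M0M thM] := bad M0.
  have Uth := @ulim_gt _ U UU _ _ (t1_bounded (alg_sqr AD1 (Dav M))) thM.
  apply: filterS2 (ultra_ge oo_U M) Uth => k /= Mk thMk.
  have bM : inord M \in b k by rewrite unfold_in /b inordK.
  have mM : (M <= m k)%N.
    by rewrite -[leqLHS](@inordK k) //; exact: (leq_bigmax_cond _ bM).
  have [|i bi mi] := @eq_bigmax_cond _ (mem (b k)) (fun i => i : nat).
    by apply/card_gt0P; exists (inord M).
  rewrite /m mi in mM *; split; [exact: leq_trans mM|exact: (b0 _ _ bi)|].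
  by move: bi; rewrite unfold_in.
pose K k := (m k).-1.
have K_oo n : U [set k | (n <= K k)%N].
  by apply: filterS (Ubad n.+1) => k [/= nm m0 _]; rewrite -ltnS prednK.
(* With the averages at the last bad times as weight, the dual function correlates with [h] exactly
   by the squared norm of these averages. *)
pose a z := step_average (K z.2).+1 h z.
have D1a : D1 a.
  have [[H hH] Dh] := D1h; have [B B0 pB] := p_bounded; split=> [|k].
    by exists (B * H) => z; exact: step_bounded.
  exact: (D_step (K k).+1 (Dh k)).
have alpha_gt : th <= t1 (fun z => a z ^+ 2).
  apply: ulim_ge; first exact: (t1_bounded (alg_sqr AD1 D1a)).
  apply: filterS (Ubad 0%N) => k [/= _ m0 thm].
  by rewrite /a /= prednK // ltW.
set alpha := t1 _ in alpha_gt.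
pose s := dual_function K a.
have D1s : D1 s by exact: D1_dual.
have hs : t1 (fun z => h z * s z) = alpha.
  by congr ulim; apply/funext => k; exact: dual_pairing.
have ss : t1 (fun z => s z ^+ 2) <= C * alpha.
  have Da2 := alg_sqr AD1 D1a.
  rewrite -(meanZ M1) //; apply: ulim_eventually_le.
  - exact: (t1_bounded (alg_sqr AD1 D1s)).
  - exact: (t1_bounded (algZ AD1 C Da2)).
  apply: filterS filterT => k _ /=; rewrite (meanZ Mt); last exact: (slice1 k Da2).
  exact: dual_sqr_le.
(* The choice c = 1/C minimises -2c alpha + c^2 C alpha, with value -alpha/C. Hence alpha <= C eta,
   against alpha >= 2 C eta. *)
have := horth s C^-1 (dual_step_cauchy K_oo D1a).
rewrite (_ : (fun z => (h z - _) ^+ 2) = fun z =>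
  (h z ^+ 2 - (2 * C^-1) * (h z * s z)) + C^-1 ^+ 2 * s z ^+ 2); last first.
  by apply/funext => z; ring.
have Dh2 := alg_sqr AD1 D1h.
have Dhs : D1 (fun z => (2 * C^-1) * (h z * s z)).
  by apply: (algZ AD1); exact: (algM AD1).
rewrite (meanD M1); [|exact: (algB AD1)|by apply: (algZ AD1); exact: (alg_sqr AD1)].
rewrite (meanB AD1 M1) // (meanZ M1); last exact: (algM AD1).
rewrite (meanZ M1); last exact: (alg_sqr AD1).
rewrite hs => le1.
have le2 : C^-1 ^+ 2 * t1 (fun z => s z ^+ 2) <= C^-1 * alpha.
  apply: (le_trans (ler_wpM2l (sqr_ge0 _) ss)).
  by rewrite expr2 -mulrA mulKf ?gt_eqF.
have : C^-1 * alpha <= eta by lra.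
rewrite ler_pdivrMl // => le3.
have : 0 < C * eta by rewrite mulr_gt0.
by rewrite /th in alpha_gt; lra.
Qed.

(** * Conclusion of the induction *)

Lemma multiple_average_step : cauchy_mean tau (multiple_average l.+1 T f).
Proof.
move=> e e0; have [C C0 pC] := p_sqr_bound.
pose F0 (z : Y * nat) := f l z.1.
have D1F0 : D1 F0 by exact: fiber_alg_fst.
have avE M y k : multiple_average l.+1 T f M y = step_average M F0 (y, k).
  by congr (_ * _); apply: eq_bigr => n _; rewrite big_ord_recr.
pose dist := [set t1 (fun z => (F0 z - g z) ^+ 2) | g in step_cauchy].
have sqr_t1 g : D1 g -> 0 <= t1 (fun z => g z ^+ 2).
  move=> Dg; apply: (mean_ge0 M1); first exact: (alg_sqr AD1).
  by move=> z; exact: sqr_ge0.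
have has_inf_dist : has_inf dist.
  split; first by exists (t1 (fun z => (F0 z - 0) ^+ 2)); exists (fun=> 0) => //;
    exact: step_cauchy0.
  by exists 0 => _ [g [Dg _] <-]; apply: sqr_t1; exact: (algB AD1).
(* The averages of [h] will have squared norm at most 2 C eta = e/16. Two uses of [mean_sqrD] make
   their part e/2, and the averages of [g] give 2 (e/4). *)
pose eta := e / (32 * C).
have eta0 : 0 < eta by rewrite divr_gt0 // mulr_gt0.
have [_ [g Vg <-] gd] := inf_adherent eta0 has_inf_dist.
have [D1g cg] := Vg.
pose h z := F0 z - g z.
have D1h : D1 h by exact: (algB AD1).
(* V is linear, so [g + c * s] competes in the infimum that [g] attains up to [eta]. *)
have horth s c : step_cauchy s ->
    t1 (fun z => h z ^+ 2) <= t1 (fun z => (h z - c * s z) ^+ 2) + eta.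
  move=> Vs; apply: (le_trans (ltW gd)); rewrite lerD2r.
  apply: (ge_inf has_inf_dist.2); exists (fun z => g z + c * s z).
    exact: step_cauchy_linear.
  by congr t1; apply/funext => z; rewrite /h; ring.
have [M0 hM0] := almost_orthogonal_small C0 eta0 pC D1h horth.
have [N0 gN0] := cg _ (divr_gt0 e0 (ltr0n _ 4 : 0 < 4%:R)).
exists (maxn M0 N0) => M N; rewrite !geq_max => /andP[M1' M2] /andP[N1 N2].
have avh K : D1 (step_average K h) by exact: D1_step.
have avg K : D1 (step_average K g) by exact: D1_step.
(* [F0] is a constant sequence, so [tau] is the ultralimit of a constant; then [F0] is split as
   [g + h]. *)
rewrite (_ : tau _ = t1 (fun z => ((step_average M g z - step_average N g z) +
    (step_average M h z + -1 * step_average N h z)) ^+ 2)); last first.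
  rewrite -[LHS](@ulim_cst _ U); congr ulim; apply/funext => k.
  congr tau; apply/funext => y; rewrite !(avE _ _ k).
  have split_av K : step_average K F0 (y, k) =
      step_average K g (y, k) + 1 * step_average K h (y, k).
    rewrite -step_linear; congr step_average; apply/funext => z.
    by rewrite /h mul1r addrC subrK.
  by rewrite !split_av; congr (_ ^+ 2); ring.
have DN : D1 (fun z => -1 * step_average N h z) by exact: (algZ AD1).
apply: (le_trans (mean_sqrD AD1 M1 _ _)).
- exact: (algB AD1).
- exact: (algD AD1).
have := mean_sqrD AD1 M1 (avh M) DN.
under [X in _ + 2 * t1 X]eq_fun do rewrite mulN1r sqrrN.
have := hM0 _ M1'; have := hM0 _ N1; have := gN0 _ _ M2 N2.
have : C * eta = e / 32 by rewrite /eta; field; rewrite gt_eqF.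
rewrite -!mulrA => ->; lra.
Qed.

End InductionStep.

Theorem multiple_average_cauchy l : multiple_averages_cauchy l.
Proof.
elim: l => [|l IHl] Y D tau T S f AD Mt pT pS TK SK TC Df.
  (* An empty product is 1, so the averages equal 1 from N = 1 on; at N = 0 the average is 0. *)
  move=> e e0; exists 1%N => M N M0 N0.
  have avg1 K y : (0 < K)%N -> multiple_average 0 T f K y = 1.
    move=> K0; rewrite /multiple_average (eq_bigr (fun=> 1)) => [|n _].
      by rewrite sumr_const card_ord mulVf // pnatr_eq0 -lt0n.
    by rewrite big_ord0.
  rewrite (_ : (fun _ => _) = fun=> 0) ?(mean_cst AD Mt) ?ltW //.
  by apply/funext => y; rewrite !avg1 // subrr expr0n.
(* Any ultrafilter refining the filter of cofinite sets. *)
have [U [UU oo_U]] := @ultraFilterLemma _ \oo _.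
exact: (multiple_average_step IHl AD Mt pT pS TK SK TC Df oo_U).
Qed.

End MultipleAverages.

(** * The system of bounded measurable functions on a probability space *)

Section BoundedMeasurable.
Context {R : realType} d (X : measurableType d) (mu : probability X R).

Definition bounded_mfun : set (X -> R) :=
  [set f : X -> R | measurable_fun [set: X] f /\ exists C : R, forall x, `|f x| <= C].

Lemma bounded_mfun_algebra : function_algebra bounded_mfun.
Proof.
split=> [f []//|c|f g [mf [A fA]] [mg [B gB]]|f g [mf [A fA]] [mg [B gB]]].
- by split; [exact: measurable_cst|exists (Num.norm c)].
- split; first exact: measurable_funD.
  by exists (A + B) => z; rewrite (le_trans (ler_normD _ _)) // lerD.
- split; first exact: measurable_funM.
  by exists (A * B) => z; rewrite normrM ler_pM.
Qed.

Let muTlty : (mu [set: X] < +oo)%E.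
Proof. by rewrite probability_setT ltry. Qed.

Lemma bounded_mfun_integrable f : bounded_mfun f ->
  mu.-integrable [set: X] (EFin \o f).
Proof.
move=> [mf [C fC]]; apply: measurable_bounded_integrable => //.
exists C; split; first exact: num_real.
by move=> y Cy x _ /=; rewrite (le_trans (fC x)) // ltW.
Qed.

Lemma Rintegral_mean : mean bounded_mfun (fun f => \int[mu]_x f x).
Proof.
split.
- by move=> f g Df Dg; rewrite RintegralD //; exact: bounded_mfun_integrable.
- by move=> c f Df; rewrite RintegralZl //; exact: bounded_mfun_integrable.
- by move=> f _ f0; apply: Rintegral_ge0 => x _.
- by rewrite Rintegral_cst // mul1r -[RHS]/(fine 1%E) -(probability_setT mu).
Qed.

Lemma measure_preserving_preserves (T : X -> X) : measure_preserving mu T ->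
  preserves bounded_mfun (fun f => \int[mu]_x f x) T.
Proof.
move=> [mT muT].
have Df f : bounded_mfun f -> bounded_mfun (fun y => f (T y)).
  move=> [mf [C fC]]; split; last by exists C.
  exact: measurableT_comp.
split=> // f bf; congr fine.
rewrite -[LHS](@integral_pushforward _ _ X X R T mT mu [set: X] (EFin \o f)) //.
- apply: eq_measure_integral => A mA _; exact: muT.
- by apply/measurable_EFinP; case: bf.
- by rewrite preimage_setT; exact: (bounded_mfun_integrable (Df _ bf)).
Qed.

(** * Quadratic limits of uniformly bounded Cauchy sequences *)

Section Completeness.
Context (u : nat -> X -> R) (C : R).
Context (mu_ : forall n, measurable_fun [set: X] (u n)).
Context (uC : forall n x, `|u n x| <= C).
Context (cu : cauchy_mean (fun f => \int[mu]_x f x) u).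

Let AD := bounded_mfun_algebra.
Let Mt := Rintegral_mean.

Let Du n : bounded_mfun (u n).
Proof. by split=> //; exists C. Qed.

(** With t = 2^-j, the inequality |z| <= t/2 + z^2/(2t) turns the bound t^2 on the mean square into
    the bound t on the mean modulus. *)
Let subseq : exists s : nat -> nat, forall j,
  \int[mu]_x `|u (s j.+1) x - u (s j) x| <= 2^-1 ^+ j /\ (j <= s j)%N.
Proof.
have h0 j : 0 < 2^-1 ^+ j :> R by rewrite exprn_gt0.
have /choice[n0 n0P] j := cu (exprn_gt0 2 (h0 j)).
(* Partial sums make [s] increasing and at least [n0]; the successors give s j >= j. *)
pose s j := (\sum_(i < j.+1) (n0 i).+1)%N.
have n0s j : (n0 j <= s j)%N.
  by rewrite /s big_ord_recr /= (leq_trans _ (leq_addl _ _)).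
have ss j : (s j <= s j.+1)%N by rewrite [s j.+1]/s big_ord_recr leq_addr.
exists s => j; split; last first.
  elim: j => [//|j IH].
  by rewrite [s _]/s big_ord_recr /= addnS ltnS (leq_trans IH) ?leq_addr.
pose t : R := 2^-1 ^+ j.
have Dd : bounded_mfun (fun x => u (s j.+1) x - u (s j) x) by exact: (algB AD).
have Dsq := algZ AD (t^-1 / 2) (alg_sqr AD Dd).
have Dh : bounded_mfun (fun x => t / 2 + t^-1 / 2 * (u (s j.+1) x - u (s j) x) ^+ 2).
  by apply: (algD AD) => //; exact: (alg_cst AD).
apply: (@le_trans _ _ (\int[mu]_x (t / 2 + t^-1 / 2 * (u (s j.+1) x - u (s j) x) ^+ 2))).
  apply: (mean_le AD Mt) => //.
    case: Dd => md [B dB]; split; first exact: measurableT_comp.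
    by exists B => x; rewrite normr_id.
  move=> x; rewrite -[in leRHS]real_normK ?num_real //.
  set z := `|_|; rewrite -subr_ge0.
  rewrite (_ : _ - _ = t^-1 / 2 * (z - t) ^+ 2).
    by rewrite mulr_ge0 ?sqr_ge0 // divr_ge0 // invr_ge0 ltW ?h0.
  by field; rewrite gt_eqF ?h0.
rewrite (meanD Mt) //; last exact: (alg_cst AD).
rewrite (mean_cst AD Mt) (meanZ Mt); last exact: (alg_sqr AD).
have := n0P j _ _ (leq_trans (n0s j) (ss j)) (n0s j); rewrite -/t => le1.
have t0 : 0 <= t^-1 / 2 by rewrite divr_ge0 // invr_ge0 ltW ?h0.
have := ler_wpM2l t0 le1.
have -> : t^-1 / 2 * t ^+ 2 = t / 2 by field; rewrite gt_eqF ?h0.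
lra.
Qed.

(** The sum of the increments has integral at most 2, so it is finite almost everywhere and the
    telescoping series converges absolutely there. *)
Let ae_subseq_cvg (s : nat -> nat) :
  (forall j, \int[mu]_x `|u (s j.+1) x - u (s j) x| <= 2^-1 ^+ j) ->
  {ae mu, forall x, cvgn (fun j => u (s j) x)}.
Proof.
move=> sP.
pose D j (x : X) : \bar R := `|u (s j.+1) x - u (s j) x|%:E.
have mD j : measurable_fun [set: X] (D j).
  by apply/measurable_EFinP; apply: measurableT_comp => //; exact: measurable_funB.
have D0 j x : (0 <= D j x)%E by rewrite lee_fin.
have iD j : (\int[mu]_x D j x <= (2^-1 ^+ j)%:E)%E.
  have bD : bounded_mfun (fun x => `|u (s j.+1) x - u (s j) x|).
    have [md [B dB]] := algB AD (Du (s j.+1)) (Du (s j)).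
    split; first exact: measurableT_comp.
    by exists B => x; rewrite normr_id.
  have := sP j; rewrite /Rintegral -lee_fin fineK //.
  exact: integrable_fin_num (bounded_mfun_integrable bD).
pose Phi x := (\sum_(j <oo) D j x)%E.
have mPhi : measurable_fun [set: X] Phi by exact: ge0_emeasurable_sum.
have iPhi : mu.-integrable [set: X] Phi.
  apply/integrableP; split => //.
  under eq_integral do rewrite gee0_abs ?nneseries_ge0 //.
  rewrite integral_nneseries //.
  apply: (@le_lt_trans _ _ 2%:E); last exact: ltry.
  apply: lime_le.
    by apply: is_cvg_nneseries => *; exact: integral_ge0.
  apply: nearW => n; apply: (@le_trans _ _ (\sum_(0 <= j < n) (2^-1 ^+ j)%:E)%E).
    by apply: lee_sum => j _; exact: iD.
  rewrite sumEFin lee_fin.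
  have -> : \sum_(0 <= j < n) 2^-1 ^+ j = 2 - 2 * 2^-1 ^+ n :> R.
    elim: n => [|n IH]; first by rewrite big_nil expr0; lra.
    by rewrite big_nat_recr //= IH exprS; lra.
  by rewrite lerBlDr lerDl mulr_ge0 // exprn_ge0.
have := integrable_ae measurableT iPhi; apply: filterS => x /(_ I) Phix.
pose w j := u (s j.+1) x - u (s j) x.
have : cvgn (series w).
  apply: normed_cvg; apply: nondecreasing_is_cvgn.
    by apply: nondecreasing_series => *; exact: normr_ge0.
  exists (fine (Phi x)) => _ [n _ <-].
  rewrite -lee_fin fineK // /series /= -sumEFin.
  exact: (nneseries_lim_ge (u_ := D ^~ x)).
move=> cw.
have -> : (fun j => u (s j) x) = fun j => u (s 0%N) x + series w j.
  apply/funext => j; rewrite /series /= /w telescope_sumr //.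
  by rewrite addrC subrK.
by apply: is_cvgD => //; exact: is_cvg_cst.
Qed.

Lemma bounded_cauchy_limit : exists g : X -> R, bounded_mfun g /\
  forall e, 0 < e -> exists N0, forall N, (N0 <= N)%N ->
    \int[mu]_x (u N x - g x) ^+ 2 <= e.
Proof.
have [s sP] := subseq.
have cvs : {ae mu, forall x, cvgn (fun j => u (s j) x)}.
  by apply: ae_subseq_cvg => j; have [] := sP j.
(* The upper limit is measurable and defined at every point; truncation makes [g] bounded
   everywhere. *)
pose g0 x : R := fine (limn_esup (fun j => (u (s j) x)%:E)).
pose g x : R := Num.max (- C) (Num.min C (g0 x)).
have mg : measurable_fun [set: X] g.
  apply: measurable_maxr => //; apply: measurable_minr => //.
  apply: measurableT_comp => //.
  apply: measurable_fun_limn_esup => j; exact/measurable_EFinP.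
have gC x : `|g x| <= `|C|.
  rewrite /g ler_norml; have := ler_norm C; have := ler_norm (- C).
  rewrite normrN => h1 h2.
  by rewrite le_max ge_max ge_min h2 (le_trans _ (_ : - C <= _)) //; lra.
have gcv : {ae mu, forall x, (fun j => u (s j) x) @ \oo --> g x}.
  apply: filterS cvs => x cx.
  have gE : g0 x = limn (fun j => u (s j) x).
    have cE : (u (s j) x)%:E @[j --> \oo] --> (limn (fun j => u (s j) x))%:E.
      by apply/fine_cvgP; split; [exact: nearW|exact: cx].
    by rewrite /g0 (cvg_limn_einf_sup cE).2.
  suff -> : g x = limn (fun j => u (s j) x) by [].
  rewrite /g gE; set L := limn _.
  have LC : L <= C.
    by apply: limr_le => //; apply: nearW => j; have := uC (s j) x;
      rewrite ler_norml => /andP[].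
  have CL : - C <= L.
    by apply: limr_ge => //; apply: nearW => j; have := uC (s j) x;
      rewrite ler_norml => /andP[].
  by rewrite min_r // max_r.
have bg : bounded_mfun g by split=> //; exists `|C|.
exists g; split=> // e e0.
have [N0 N0P] := cu e0.
exists N0 => N N0N.
have bNj j : bounded_mfun (fun x => (u N x - u (s j) x) ^+ 2).
  by apply: (alg_sqr AD); exact: (algB AD).
have bNg : bounded_mfun (fun x => (u N x - g x) ^+ 2).
  by apply: (alg_sqr AD); exact: (algB AD).
(* Dominated convergence lets j tend to infinity in the Cauchy estimate between [u N] and
   [u (s j)]. *)
have [] := @dominated_convergence _ X R mu [set: X] measurableT
  (fun j x => ((u N x - u (s j) x) ^+ 2)%:E)
  (fun x => ((u N x - g x) ^+ 2)%:E) (fun=> (((C + C) ^+ 2)%:E)).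
- by move=> j; apply/measurable_EFinP; have [] := bNj j.
- by apply/measurable_EFinP; have [] := bNg.
- apply: filterS gcv => x cx _; apply/fine_cvgP; split; first exact: nearW.
  by apply: cvgM; apply: cvgB => //; exact: cvg_cst.
- exact: (bounded_mfun_integrable (alg_cst AD _)).
- apply: nearW => x j _; rewrite gee0_abs ?lee_fin ?sqr_ge0 //.
  rewrite -[leLHS]real_normK ?num_real // ler_sqr ?nnegrE //; last first.
    by rewrite addr_ge0 // (le_trans _ (uC N x)).
  by rewrite (le_trans (ler_normB _ _)) // lerD.
move=> _ _ dcv; rewrite -lee_fin.
rewrite fineK; last exact: (integrable_fin_num measurableT
  (bounded_mfun_integrable bNg)).
rewrite -(cvg_lim _ dcv) //; apply: lime_le; first exact: (cvgP _ dcv).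
exists N0 => // j /= N0j; have sj : (N0 <= s j)%N.
  by have [_ /(leq_trans N0j)] := sP j.
rewrite -[leLHS]fineK ?lee_fin; last exact: (integrable_fin_num measurableT
  (bounded_mfun_integrable (bNj j))).
exact: N0P.
Qed.

End Completeness.
End BoundedMeasurable.

(** * Expansion of complex products into real and imaginary parts *)

Section ComplexExpansion.
Context {R : realType} (X : Type) (l : nat).
Implicit Types (T : 'I_l -> X -> X) (f : 'I_l -> X -> R[i]).

Definition real_average T (F : 'I_l -> X -> R) (N : nat) (x : X) : R :=
  N%:R^-1 * \sum_(n < N) \prod_(i < l) F i (iter n (T i) x).

Definition part (phi : {ffun 'I_l -> bool}) f (i : 'I_l) (x : X) : R :=
  if phi i then complex.Re (f i x) else complex.Im (f i x).

Definition part_coef (phi : {ffun 'I_l -> bool}) : R[i] :=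
  \prod_(i < l) (if phi i then 1 else 'i%C).

Lemma prod_expand (z : 'I_l -> R[i]) : \prod_(i < l) z i =
  \sum_(phi : {ffun 'I_l -> bool}) part_coef phi *
    (\prod_(i < l) (if phi i then complex.Re (z i) else complex.Im (z i)))%:C.
Proof.
rewrite (eq_bigr (fun i => \sum_(b : bool) (if b then 1 else 'i%C) *
    (if b then complex.Re (z i) else complex.Im (z i))%:C)); last first.
  by move=> i _; rewrite big_bool /= mul1r -complexE.
rewrite bigA_distr_bigA; apply: eq_bigr => phi _.
by rewrite big_split /= rmorph_prod.
Qed.

Lemma ReD (z w : R[i]) : complex.Re (z + w) = complex.Re z + complex.Re w.
Proof. by case: z w => [a b] [c e]. Qed.

Lemma ImD (z w : R[i]) : complex.Im (z + w) = complex.Im z + complex.Im w.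
Proof. by case: z w => [a b] [c e]. Qed.

Lemma ReMr (z : R[i]) (r : R) : complex.Re (z * r%:C) = complex.Re z * r.
Proof. by case: z => a b /=; rewrite mulr0 subr0. Qed.

Lemma ImMr (z : R[i]) (r : R) : complex.Im (z * r%:C) = complex.Im z * r.
Proof. by case: z => a b /=; rewrite mulr0 add0r. Qed.

End ComplexExpansion.

(** * From complex essentially bounded functions to real bounded ones *)

Section Main.
Context {R : realType} (l : nat) d (X : measurableType d).
Implicit Types (T : 'I_l -> X -> X) (f : 'I_l -> X -> R[i]).

(** The coefficients depend neither on N nor on x, so convergence reduces to that of finitely many
    real averages. *)
Lemma average_expand T f N x : ergodic_average T f N x =
  \sum_(phi : {ffun 'I_l -> bool})
    part_coef phi * (real_average T (part phi f) N x)%:C.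
Proof.
rewrite /ergodic_average.
under eq_bigr do rewrite prod_expand.
rewrite exchange_big /= mulr_sumr; apply: eq_bigr => phi _.
rewrite /real_average rmorphM fmorphV rmorph_nat mulrCA rmorph_sum /=.
by congr (_ * _); rewrite mulr_sumr.
Qed.

Lemma Re_average T f N x : complex.Re (ergodic_average T f N x) =
  \sum_(phi : {ffun 'I_l -> bool})
    complex.Re (part_coef phi) * real_average T (part phi f) N x.
Proof.
rewrite average_expand (big_morph _ (@ReD R) (erefl : complex.Re 0 = 0)).
by apply: eq_bigr => phi _; exact: ReMr.
Qed.

Lemma Im_average T f N x : complex.Im (ergodic_average T f N x) =
  \sum_(phi : {ffun 'I_l -> bool})
    complex.Im (part_coef phi) * real_average T (part phi f) N x.
Proof.
rewrite average_expand (big_morph _ (@ImD R) (erefl : complex.Im 0 = 0)).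
by apply: eq_bigr => phi _; exact: ImMr.
Qed.

Lemma measurable_fun_iter (S : X -> X) n :
  measurable_fun [set: X] S -> measurable_fun [set: X] (iter n S).
Proof.
move=> mS; elim: n => [|n IH]; first exact: measurable_id.
exact: measurableT_comp.
Qed.

Lemma measurable_real_average T (F : 'I_l -> X -> R) N :
  (forall i, measurable_fun [set: X] (T i)) ->
  (forall i, measurable_fun [set: X] (F i)) ->
  measurable_fun [set: X] (real_average T F N).
Proof.
move=> mT mF; apply: measurable_funM => //.
apply: measurable_sum => n; apply: measurable_prod => i _.
by apply: measurableT_comp => //; exact: measurable_fun_iter.
Qed.

Lemma measurable_average T f N :
  (forall i, measurable_fun [set: X] (T i)) ->
  (forall i, measurable_fun [set: X] (fun x => complex.Re (f i x))) ->
  (forall i, measurable_fun [set: X] (fun x => complex.Im (f i x))) ->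
  measurable_fun [set: X] (fun x => complex.Re (ergodic_average T f N x)) /\
  measurable_fun [set: X] (fun x => complex.Im (ergodic_average T f N x)).
Proof.
move=> mT mRe mIm.
have mp phi i : measurable_fun [set: X] (part phi f i).
  by rewrite /part; case: (phi i).
split.
- under eq_fun do rewrite Re_average; apply: measurable_sum => phi.
  by apply: measurable_funM => //; exact: measurable_real_average.
- under eq_fun do rewrite Im_average; apply: measurable_sum => phi.
  by apply: measurable_funM => //; exact: measurable_real_average.
Qed.

Context (mu : probability X R).

Lemma measure_preserving_iter (S : X -> X) n :
  measure_preserving mu S -> measure_preserving mu (iter n S).
Proof.
move=> [mS muS]; elim: n => [|n [mi mui]]; first by split=> //; exact: measurable_id.
split; first exact: measurable_fun_iter.
move=> A mA; rewrite -[RHS](muS A mA) -[RHS]mui //.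
by rewrite -[X in measurable X]setTI; exact: mS.
Qed.

Lemma ae_measure_preserving (S : X -> X) (P : X -> Prop) :
  measure_preserving mu S -> {ae mu, forall x, P x} ->
  {ae mu, forall x, P (S x)}.
Proof.
move=> [mS muS] [A [mA A0 PA]]; exists (S @^-1` A); split.
- by rewrite -[X in measurable X]setTI; exact: mS.
- by rewrite /= muS.
- by move=> x nP; apply: PA.
Qed.

(** The exceptional sets pulled back by the powers of the [T i] are null and countably many, so one
    null set serves all N. *)
Lemma ae_average_eq T f g :
  (forall i, measure_preserving mu (T i)) ->
  (forall i, {ae mu, forall x, f i x = g i x}) ->
  {ae mu, forall x, forall N, ergodic_average T f N x = ergodic_average T g N x}.
Proof.
move=> pT fg.
have : {ae mu, forall x, forall n i, f i (iter n (T i) x) = g i (iter n (T i) x)}.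
  apply: ae_foralln => n; apply: filter_forall => i.
  exact: (ae_measure_preserving (P := fun y => f i y = g i y)
    (measure_preserving_iter n (pT i)) (fg i)).
apply: filterS => x fgx N; congr (_ * _); apply: eq_bigr => n _.
by apply: eq_bigr => i _.
Qed.

Lemma cLfun_oo_bounded (h : X -> R[i]) : cLfun mu +oo%E h ->
  exists C : R, 0 <= C /\ {ae mu, forall x, Normc.normc (h x) <= C}.
Proof.
move=> [_ _]; rewrite /cLnorm unlock /Lnorm.
(* The [+oo] norm is the essential supremum only on a space of positive measure. *)
case: ifPn => [_ hoo|/negP[]]; last first.
  by have := @lte01 R; rewrite -(probability_setT mu).
have [C hC] : exists C : R, (ess_sup mu (abse \o (EFin \o cabs h)) <= C%:E)%E.
  case: ess_sup hoo => [r _|//|_]; first by exists r.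
  by exists 0; exact: leNye.
exists `|C|; split=> //; have /ess_supP := hC; apply: filterS => x /=.
by rewrite lee_fin => h1; rewrite (le_trans (ler_norm _)) // (le_trans h1) // ler_norm.
Qed.

Lemma cLnorm2E (h : X -> R[i]) : cLnorm mu 2%:E h =
  ((\int[mu]_x (complex.Re (h x) ^+ 2 + complex.Im (h x) ^+ 2)%:E) `^ 2^-1)%E.
Proof.
rewrite /cLnorm unlock /Lnorm; congr (_ `^ _)%E; apply: eq_integral => x _.
rewrite /= /cabs; case: (h x) => a b /=.
have ab0 : 0 <= a ^+ 2 + b ^+ 2 by rewrite addr_ge0 ?sqr_ge0.
rewrite powR_mulrn ?normr_ge0 // real_normK ?num_real //.
by rewrite sqr_sqrtr.
Qed.

Lemma Re_normc (z : R[i]) : `|complex.Re z| <= Normc.normc z.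
Proof.
case: z => a b /=; rewrite -sqrtr_sqr ler_sqrt ?addr_ge0 ?sqr_ge0 //.
by rewrite lerDl sqr_ge0.
Qed.

Lemma Im_normc (z : R[i]) : `|complex.Im z| <= Normc.normc z.
Proof.
case: z => a b /=; rewrite -sqrtr_sqr ler_sqrt ?addr_ge0 ?sqr_ge0 //.
by rewrite lerDr sqr_ge0.
Qed.

(** Truncation to [-C, C]: an essentially bounded function becomes bounded at every point. *)
Definition clip (C r : R) : R := Num.max (- C) (Num.min C r).

Lemma clip_bounded C r : `|clip C r| <= `|C|.
Proof.
rewrite /clip ler_norml; have := ler_norm C; have := ler_norm (- C).
rewrite normrN => h1 h2.
by rewrite le_max ge_max ge_min h2 (le_trans _ (_ : - C <= _)) //; lra.
Qed.

Lemma clip_id C r : `|r| <= C -> clip C r = r.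
Proof.
rewrite ler_norml => /andP[Cr rC].
by rewrite /clip min_r // max_r.
Qed.

(** Families over ['I_l] are extended to [nat] by [inord], for which l must be a successor; each new
    entry is one of the old ones, so the hypotheses persist. *)
Lemma real_average_cauchy T (F : 'I_l -> X -> R) : (0 < l)%N ->
  (forall i, invertible_measure_preserving mu (T i)) ->
  (forall i j, T i \o T j = T j \o T i) ->
  (forall i, bounded_mfun (F i)) ->
  cauchy_mean (fun h : X -> R => \int[mu]_x h x) (real_average T F).
Proof.
case: l T F => [//|l'] T F _ iT cT bF.
have /choice[S SP] i : exists S : X -> X,
    [/\ cancel (T i) S, cancel S (T i) & measurable_fun [set: X] S].
  by case: (iT i).
(* Invariance under [T i] applied to the preimage of A by [S i]. *)
have pS i : measure_preserving mu (S i).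
  have [TK SK mS] := SP i; split=> // A mA.
  rewrite -[LHS](iT i).1.2; last by rewrite -[X in measurable X]setTI; exact: mS.
  by congr (mu _); apply/funext => x /=; rewrite TK.
pose T' n := T (inord n); pose S' n := S (inord n); pose F' n := F (inord n).
have -> : real_average T F = multiple_average l'.+1 T' F'.
  apply/funext => N; apply/funext => x; congr (_ * _); apply: eq_bigr => n _.
  by apply: eq_bigr => i _; rewrite /F' /T' inord_val.
apply: (@multiple_average_cauchy R l'.+1 X _ _ T' S' F'
  (bounded_mfun_algebra X) (Rintegral_mean mu)).
- by move=> i; apply: measure_preserving_preserves; exact: (iT _).1.
- by move=> i; exact: (measure_preserving_preserves (pS (inord i))).
- by move=> i; have [TK _ _] := SP (inord i); exact: TK.
- by move=> i; have [_ SK _] := SP (inord i); exact: SK.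
- by move=> i j y; have /(congr1 (@^~ y)) := cT (inord i) (inord j).
- by move=> i; exact: bF.
Qed.

End Main.

(** * Assembly of the limit in L^2 *)

Lemma cauchy_mean_sum (R : realType) (Y : Type) (D : set (Y -> R))
    (tau : (Y -> R) -> R) (I : Type) (r : seq I) (c : I -> R)
    (u : I -> nat -> Y -> R) :
  function_algebra D -> mean D tau -> (forall i N, D (u i N)) ->
  (forall i, cauchy_mean tau (u i)) ->
  cauchy_mean tau (fun N y => \sum_(i <- r) c i * u i N y).
Proof.
move=> AD Mt Du cu; elim: r => [|i r IH].
  move=> e e0; exists 0%N => M N _ _.
  under eq_fun do rewrite !big_nil subrr expr0n /=.
  by rewrite (mean_cst AD Mt) ltW.
rewrite (_ : (fun N _ => _) =
  fun N y => c i * u i N y + \sum_(j <- r) c j * u j N y); last first.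
  by apply/funext => N; apply/funext => y; rewrite big_cons.
apply: (cauchy_meanD AD Mt) => //.
- by move=> N; exact: (algZ AD).
- by move=> N; apply: (alg_sum AD) => j; exact: (algZ AD).
- exact: (cauchy_meanZ AD Mt).
Qed.

Theorem theorem1p1 (R : realType) (l : nat) (l_ge1 : (1 <= l)%N)
    (d : measure_display) (X : measurableType d) (mu : probability X R)
    (T : 'I_l -> X -> X)
    (T_imp : forall i : 'I_l, invertible_measure_preserving mu (T i))
    (T_comm : forall i j : 'I_l, T i \o T j = T j \o T i)
    (f : 'I_l -> X -> R[i])
    (f_Linfty : forall i : 'I_l, cLfun mu +oo%E (f i)) :
  exists2 g : X -> R[i], cLfun mu 2%:E g &
    cLnorm mu 2%:E (fun x => ergodic_average T f N x - g x)
      @[N --> \oo] --> 0%E.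
Proof.
have /choice[C CP] i := cLfun_oo_bounded (f_Linfty i).
(* A version of [f i] bounded everywhere: the moduli of both parts are at most [C i] almost
   everywhere. *)
pose f' i x : R[i] :=
  (clip (C i) (complex.Re (f i x)) +i* clip (C i) (complex.Im (f i x)))%C.
have ff' i : {ae mu, forall x, f i x = f' i x}.
  have [_] := CP i; apply: filterS => x fC.
  rewrite /f' !clip_id; first by case: (f i x).
    exact: le_trans (Im_normc _) fC.
  exact: le_trans (Re_normc _) fC.
have mT i : measurable_fun [set: X] (T i) by exact: (T_imp i).1.1.
have mclip c (h : X -> R) : measurable_fun [set: X] h ->
    measurable_fun [set: X] (fun x => clip c (h x)).
  by move=> mh; apply: measurable_maxr => //; exact: measurable_minr.
have mRe i : measurable_fun [set: X] (fun x => complex.Re (f' i x)).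
  by have [mr _ _] := f_Linfty i; exact: mclip.
have mIm i : measurable_fun [set: X] (fun x => complex.Im (f' i x)).
  by have [_ mi _] := f_Linfty i; exact: mclip.
have part_le phi i x : `|part phi f' i x| <= `|C i|.
  by rewrite /part; case: (phi i); exact: clip_bounded.
have bpart phi i : bounded_mfun (part phi f' i).
  split; last by exists `|C i|.
  by rewrite /part; case: (phi i).
pose B := \prod_(i < l) `|C i|.
have B0 : 0 <= B by apply: prodr_ge0.
have avg_le phi N x : `|real_average T (part phi f') N x| <= B.
  apply: (average_norm_le
    (b := fun n => \prod_(i < l) part phi f' i (iter n (T i) x))) => // n _.
  by rewrite normr_prod ler_prod // => i _; rewrite normr_ge0 part_le.
have bavg phi N : bounded_mfun (real_average T (part phi f') N).
  split; last by exists B.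
  by apply: measurable_real_average => // i; case: (bpart phi i).
have AD := @bounded_mfun_algebra R d X; have Mt := Rintegral_mean mu.
(* For the coefficients [cr] and [ci] these are the real and imaginary parts of the averages of
   [f']. *)
pose comb (c : {ffun 'I_l -> bool} -> R) N x :=
  \sum_(phi : {ffun 'I_l -> bool}) c phi * real_average T (part phi f') N x.
have comb_limit c : exists g : X -> R, bounded_mfun g /\
    forall e, 0 < e -> exists N0, forall N, (N0 <= N)%N ->
    \int[mu]_x (comb c N x - g x) ^+ 2 <= e.
  apply: (@bounded_cauchy_limit _ _ _ mu (comb c) (\sum_phi (`|c phi| * B))).
  - by move=> N; apply: measurable_sum => phi; apply: measurable_funM => //;
      have [] := bavg phi N.
  - move=> N x; apply: (le_trans (ler_norm_sum _ _ _)).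
    by apply: ler_sum => phi _; rewrite normrM ler_wpM2l.
  - apply: (cauchy_mean_sum _ _ AD Mt) => // phi.
    exact: real_average_cauchy.
have bcomb c N : bounded_mfun (comb c N).
  by apply: (alg_sum AD) => phi; exact: (algZ AD).
pose cr (phi : {ffun 'I_l -> bool}) := complex.Re (part_coef phi : R[i]).
pose ci (phi : {ffun 'I_l -> bool}) := complex.Im (part_coef phi : R[i]).
have [[gr [bgr grP]] [gi [bgi giP]]] := (comb_limit cr, comb_limit ci).
pose g x : R[i] := (gr x +i* gi x)%C.
have bsq (u v : X -> R) : bounded_mfun u -> bounded_mfun v ->
    bounded_mfun (fun x => u x ^+ 2 + v x ^+ 2).
  by move=> bu bv; apply: (algD AD); exact: (alg_sqr AD).
have int_fin (h : X -> R) : bounded_mfun h ->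
    (\int[mu]_x (h x)%:E = (\int[mu]_x h x)%:E)%E.
  move=> bh; rewrite fineK //.
  exact: (integrable_fin_num measurableT (bounded_mfun_integrable mu bh)).
exists g.
  split; [by case: bgr|by case: bgi|].
  by rewrite cLnorm2E /= int_fin ?poweR_EFin ?ltry //; exact: bsq.
pose I N := \int[mu]_x ((comb cr N x - gr x) ^+ 2 + (comb ci N x - gi x) ^+ 2).
have bD c h N : bounded_mfun h -> bounded_mfun (fun x => comb c N x - h x).
  by move=> bh; exact: (algB AD).
have IE N : I N = \int[mu]_x (comb cr N x - gr x) ^+ 2 +
    \int[mu]_x (comb ci N x - gi x) ^+ 2.
  by apply: (meanD Mt); apply: (alg_sqr AD); exact: bD.
have I0 N : 0 <= I N.
  by apply: Rintegral_ge0 => x _; rewrite addr_ge0 ?sqr_ge0.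
have normE N : cLnorm mu 2%:E (fun x => ergodic_average T f N x - g x) =
    (Num.sqrt (I N))%:E.
  rewrite cLnorm2E -powR12_sqrt // -poweR_EFin -int_fin; last first.
    by apply: bsq; exact: bD.
  (* Replacing [f] by [f'] alters the integrand only on a null set. *)
  congr (_ `^ _)%E; apply: ae_eq_integral => //.
  - have [mr mi] := measurable_average N mT
      (fun i => let: And3 mr _ _ := f_Linfty i in mr)
      (fun i => let: And3 _ mi _ := f_Linfty i in mi).
    have ReB (z : R[i]) a b : complex.Re (z - (a +i* b)%C) = complex.Re z - a.
      by case: z.
    have ImB (z : R[i]) a b : complex.Im (z - (a +i* b)%C) = complex.Im z - b.
      by case: z.
    apply/measurable_EFinP; apply: measurable_funD; apply: measurable_funX.
      under eq_fun do rewrite ReB; apply: measurable_funB => //.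
      by case: bgr.
    under eq_fun do rewrite ImB; apply: measurable_funB => //.
    by case: bgi.
  - by apply/measurable_EFinP; have [] := bsq _ _ (bD cr _ N bgr) (bD ci _ N bgi).
  have := ae_average_eq (fun i => (T_imp i).1) ff'; apply: filterS => x /(_ N) eqx _.
  rewrite eqx /comb -Re_average -Im_average.
  by case: (ergodic_average _ _ _ _).
under eq_fun do rewrite normE.
apply/fine_cvgP; split; first exact: nearW.
have I_cvg : I N @[N --> \oo] --> 0.
  apply/cvgrPdist_le => e e0; have e2 : 0 < e / 2 by rewrite divr_gt0.
  have [[N1 N1P] [N2 N2P]] := (grP _ e2, giP _ e2).
  exists (maxn N1 N2) => // N /=; rewrite geq_max => /andP[h1 h2].
  rewrite sub0r normrN ger0_norm // IE.
  by have := N1P _ h1; have := N2P _ h2; lra.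
rewrite -(sqrtr0 R).
exact: (continuous_cvg _ (@sqrt_continuous R 0) I_cvg).
Qed.
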